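(* Let $(X,\mathscr U)$ be a separated uniform space endowed with a graph $G$, let $p$ be an $E$-distance on $X$ such that $X$ is $p$-complete, and let $T:X\to X$ be an integral type $p$-$\widetilde G$-contraction such that the function $\varphi\in\Phi$ in its contractive condition (IC2) satisfies $$\int_0^{a+b}\varphi(t)\,dt\le\int_0^a\varphi(t)\,dt+\int_0^b\varphi(t)\,dt\qquad\text{for all }a,b\ge0.$$ If $G$ is weakly connected and $C_T$ is nonempty, then there exists a unique $u\in X$ such that $T^nx\stackrel{p}{\longrightarrow}u$ for all $x\in X$. In particular, (under these hypotheses) $T$ is a $p$-Picard operator if and only if $\mathrm{Fix}(T)$ is nonempty.
   Context: A uniform space is a nonempty set $X$ with a uniformity $\mathscr U$; it is separated if the intersection of all members of $\mathscr U$ is the diagonal $\Delta(X)=\{(x,x):x\in X\}$. A function $p:X\times X\to[0,+\infty)$ is an $E$-distance on $X$ if (i) for each $V\in\mathscr U$ there is $\delta>0$ such that for all $x,y,z\in X$, $p(z,x)\le\delta$ and $p(z,y)\le\delta$ imply $(x,y)\in V$; and (ii) $p(x,y)\le p(x,z)+p(z,y)$ for all $x,y,z\in X$. (No symmetry of $p$ and no condition $p(x,x)=0$ is assumed.) A sequence $\{x_n\}$ is $p$-convergent to $x$, written $x_n\stackrel{p}{\longrightarrow}x$, if $p(x_n,x)\to0$; it is $p$-Cauchy if $p(x_m,x_n)\to0$ as $m,n\to\infty$. $X$ is $p$-complete if every $p$-Cauchy sequence in $X$ is $p$-convergent to some point of $X$. A graph $G$ on $X$ is a directed graph without parallel edges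 with vertex set $V(G)=X$ and edge set $E(G)\subseteq X\times X$ containing all loops, i.e. $E(G)\supseteq\Delta(X)$. $\widetilde G$ is the graph with $V(\widetilde G)=X$ and $E(\widetilde G)=\{(x,y): (x,y)\in E(G)\text{ or }(y,x)\in E(G)\}$. A path in a graph $H$ from $x$ to $y$ is a finite sequence $(x_i)_{i=0}^N$ of vertices with $x_0=x$, $x_N=y$ and $(x_{i-1},x_i)\in E(H)$ for $i=1,\dots,N$. $G$ is weakly connected if there is a path in $\widetilde G$ between each two vertices. $\Phi$ is the class of functions $\varphi:[0,+\infty)\to[0,+\infty)$ that are Lebesgue-integrable on $[0,+\infty)$, in the sense that $\varphi$ is Lebesgue measurable and the value of the integral over $[0,+\infty)$ is allowed to be $+\infty$, and such that $\int_0^\varepsilon\varphi(t)\,dt$ is positive and finite for every $\varepsilon>0$. $T:X\to X$ is an integral type $p$-$\widetilde G$-contraction if (IC1) $(x,y)\in E(\widetilde G)$ implies $(Tx,Ty)\in E(\widetilde G)$; and (IC2) there exist $\varphi\in\Phi$ and $\alpha\in(0,1)$ such that $\int_0^{p(Tx,Ty)}\varphi(t)\,dt\le\alpha\int_0^{p(x,y)}\varphi(t)\,dt$ for all $x,y\in X$ with $(x,y)\in E(\widetilde G)$. $\mathrm{Fix}(T)$ is the set of fixed points of $T$, and $C_T=\{x\in X:(T^nx,T^mx)\in E(\widetilde G)\text{ for all }m,n\ge0\}$ (with $T^0x=x$). $T$ is a $p$-Picard operator if $T$ has a unique fixed point $u\in X$ and $T^nx\stackrel{p}{\longrightarrow}u$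 for all $x\in X$. *)

(* Defs.v *)
From mathcomp Require Import all_boot all_order all_algebra.
From mathcomp Require Import all_classical all_reals all_analysis.
Import Order.TTheory GRing.Theory Num.Theory.
Import numFieldNormedType.Exports.

Set Implicit Arguments.
Unset Strict Implicit.
Unset Printing Implicit Defensive.

Local Open Scope classical_set_scope.
Local Open Scope ring_scope.

Section uniform_space.
Context {R : realType} {X : uniformType}.

Definition separated_uniform : Prop := \bigcap_(V in @entourage X) V = diagonal.

Implicit Type p : X -> X -> R.

Definition E_distance p : Prop :=
  [/\ forall x y, 0 <= p x y,
      forall V : set (X * X), entourage V -> exists2 delta : R, 0 < delta &
        forall x y z, p z x <= delta -> p z y <= delta -> V (x, y)
    & forall x y z, p x y <= p x z + p z y].

Definition p_cvg p (x_ : nat -> X) (x : X) : Prop :=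
  (fun n => p (x_ n) x) @ \oo --> (0 : R).

Definition p_cauchy p (x_ : nat -> X) : Prop :=
  (fun mn : nat * nat => p (x_ mn.1) (x_ mn.2)) @ (\oo, \oo) --> (0 : R).

Definition p_complete p : Prop :=
  forall x_ : nat -> X, p_cauchy p x_ -> exists x, p_cvg p x_ x.

Definition Fix (T : X -> X) : set X := [set x | T x = x].

Definition p_Picard p (T : X -> X) : Prop :=
  exists u, unique (Fix T) u /\ forall x, p_cvg p (fun n => iter n T x) u.

End uniform_space.

Arguments separated_uniform X : clear implicits.

Section graph.
Context {X : choiceType}.

Record graph := Graph {
  edges : set (X * X);
  edges_loop : diagonal `<=` edges }.

Definition sym_edges (G : graph) : set (X * X) :=
  [set xy | edges G (xy.1, xy.2) \/ edges G (xy.2, xy.1)].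

Lemma sym_edges_loop G : diagonal `<=` sym_edges G.
Proof. by move=> xy d; left; exact: edges_loop. Qed.

Definition sym_graph (G : graph) : graph := Graph (@sym_edges_loop G).

Definition has_path (H : graph) (x y : X) : Prop :=
  exists2 s : seq X, path [rel a b | (a, b) \in edges H] x s & last x s = y.

Definition weakly_connected (G : graph) : Prop :=
  forall x y, has_path (sym_graph G) x y.

Definition C_ (G : graph) (T : X -> X) : set X :=
  [set x | forall m n, edges (sym_graph G) (iter n T x, iter m T x)].

End graph.

Arguments graph X : clear implicits.

Section integral_type_contraction.
Context {R : realType}.

(* R with the sigma-algebra of Lebesgue measurable sets, as opposed to the
   Borel sigma-algebra of measurableTypeR R. *)
Definition lebesgueType := caratheodory_type (@wlength R idfun)^*%mu.

(* Functions on [0, +oo[ are represented by functions on R whose values at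
   negative reals are irrelevant. *)
Implicit Type phi : R -> R.

Definition integral_from0 phi (a : R) : \bar R :=
  (\int[completed_lebesgue_measure]_(t in `[0%R, a]) (phi t)%:E)%E.

Definition Phi : set (R -> R) :=
  [set phi | [/\ forall t, 0 <= t -> 0 <= phi t,
      measurable_fun (`[0, +oo[ : set lebesgueType) (phi : lebesgueType -> R)
    & forall e : R, 0 < e -> (0 < integral_from0 phi e < +oo)%E]].

(* The function phi of the contractive condition is a parameter. *)
Definition integral_type_contraction {X : choiceType} (p : X -> X -> R)
    (G : graph X) phi (T : X -> X) : Prop :=
  [/\ forall x y, edges (sym_graph G) (x, y) ->
        edges (sym_graph G) (T x, T y),
      Phi phi
    & exists2 alpha : R, 0 < alpha < 1 &
        forall x y, edges (sym_graph G) (x, y) ->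
          (integral_from0 phi (p (T x) (T y)) <=
             alpha%:E * integral_from0 phi (p x y))%E].

End integral_type_contraction.

(* Main.v *)
(** Write f a for the integral of phi over [0, a]. The function f is
    nondecreasing and positive at positive reals, so f (a_n) -> 0 forces
    a_n -> 0.
    Along an edge f (p (T^n x) (T^n y)) <= alpha^n f (p x y), hence
    p (T^n x) (T^n y) -> 0 along edges and, by the triangle inequality, along
    paths, i.e. for all x and y. For x in C_T, subadditivity gives
    f (p x (T^(k+1) x)) <= f (p x (T x)) + alpha f (p x (T^k x)), so that
    f (p x (T^k x)) is bounded in k (and likewise f (p (T^k x) x)); the orbit
    of x is therefore p-Cauchy, and all orbits share its p-limit. *)
Require Import Defs.
From mathcomp Require Import all_boot all_order all_algebra.
From mathcomp Require Import all_classical all_reals all_analysis.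
From mathcomp Require Import measurable_realfun ring lra.
Import Order.TTheory GRing.Theory Num.Theory.
Import numFieldNormedType.Exports.

Local Open Scope classical_set_scope.
Local Open Scope ring_scope.

(** By contraposition: [e <= a i] gives [f e <= f (a i)], so [f (a i) < f e] forces [a i < e]. The
    filter is arbitrary so as to cover both sequences and double sequences. *)
Lemma cvg0_gauge {R : realType} {I : Type} {F : set_system I} {FF : Filter F}
    {f : R -> R} {a : I -> R} :
  {in Num.nneg &, {homo f : x y / x <= y}} -> (forall e : R, 0 < e -> 0 < f e) ->
  (forall i, 0 <= a i) -> f (a i) @[i --> F] --> (0 : R) ->
  a i @[i --> F] --> (0 : R).
Proof.
move=> f_nd f_gt0 a_ge0 fa0; apply/cvgr0Pnorm_lt => e e_gt0.
have := @cvgr0_norm_lt _ _ _ _ FF _ fa0 _ (f_gt0 _ e_gt0).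
apply: filterS => i /(le_lt_trans (ler_norm _)); rewrite ger0_norm//.
apply: contraTT; rewrite -!leNgt => ea.
by apply: f_nd; rewrite // nnegrE // ltW.
Qed.

Lemma integral_from0_le {R : realType} (phi : R -> R) (a b : R) :
  Phi phi -> a <= b -> (integral_from0 phi a <= integral_from0 phi b)%E.
Proof.
move=> [phi_ge0 mphi _] ab.
have mI c : measurable (`[0, c] : set (@lebesgueType R)).
  by apply: sub_caratheodory; exact: measurable_itv.
apply: ge0_subset_integral => //.
- apply/measurable_EFinP; apply: measurable_funS mphi => //.
    by apply: sub_caratheodory; exact: measurable_itv.
  by apply: subset_itvl.
- by move=> x /=; rewrite in_itv/= => /andP[/phi_ge0].
- by apply: subset_itvl; rewrite bnd_simp.
Qed.

Lemma integral_from0_fin_num {R : realType} (phi : R -> R) (a : R) :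
  Phi phi -> integral_from0 phi a \is a fin_num.
Proof.
move=> Pphi; have [phi_ge0 _ phi_int] := Pphi.
(* [Phi] gives finiteness at positive bounds only; [Num.max a 1] is such a bound above [a], whatever
   the sign of [a]. *)
have a1_gt0 : 0 < Num.max a 1 by rewrite lt_max ltr01 orbT.
rewrite ge0_fin_numE; last first.
  by apply: integral_ge0 => x /=; rewrite in_itv/= => /andP[/phi_ge0].
have /andP[_] := phi_int _ a1_gt0; apply: le_lt_trans.
by apply: integral_from0_le => //; rewrite le_max lexx.
Qed.

(** * Orbits of a contraction measured through a gauge [f] *)

Section gauge_contraction.
Context {R : realType} {X : uniformType}.
Variables (p : X -> X -> R) (G : graph X) (T : X -> X) (f : R -> R) (alpha : R).
Hypotheses (Ep : E_distance p)
  (f_nd : {in Num.nneg &, {homo f : x y / x <= y}})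
  (f_gt0 : forall e : R, 0 < e -> 0 < f e)
  (f_subadd : forall a b : R, 0 <= a -> 0 <= b -> f (a + b) <= f a + f b)
  (alpha_gt0 : 0 < alpha) (alpha_lt1 : alpha < 1)
  (T_edge : forall x y, edges (sym_graph G) (x, y) ->
     edges (sym_graph G) (T x, T y))
  (fT : forall x y, edges (sym_graph G) (x, y) ->
     f (p (T x) (T y)) <= alpha * f (p x y)).

Let p_ge0 x y : 0 <= p x y. Proof. by case: Ep. Qed.
Let p_tri x y z : p x y <= p x z + p z y. Proof. by case: Ep. Qed.

(** Monotonicity and subadditivity give [f a <= f (a + a) <= f a + f a], which also settles
    [a = 0]. *)
Let f_ge0 (a : R) : 0 <= a -> 0 <= f a.
Proof.
move=> a_ge0; have f_half : f (a + a) <= f a + f a by exact: f_subadd.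
have : f a <= f (a + a) by apply: f_nd; rewrite ?nnegrE; lra.
lra.
Qed.

Lemma iter_edge n {x y} : edges (sym_graph G) (x, y) ->
  edges (sym_graph G) (iter n T x, iter n T y).
Proof. by move=> xy; elim: n => //= n IHn; exact: T_edge. Qed.

Lemma iter_gauge_le n {x y} : edges (sym_graph G) (x, y) ->
  f (p (iter n T x) (iter n T y)) <= alpha ^+ n * f (p x y).
Proof.
move=> xy; elim: n => [|n IHn] /=; first by rewrite mul1r.
apply: le_trans (fT _ _ (iter_edge n xy)) _.
by rewrite exprS -mulrA ler_wpM2l// ltW.
Qed.

Let cvg_expr_alpha (M : R) : alpha ^+ n * M @[n --> \oo] --> (0 : R).
Proof.
rewrite -[0](mul0r M); apply: cvgMl; apply: cvg_expr.
by rewrite ger0_norm// ltW.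
Qed.

Lemma iter_cvg0_edge {x y} : edges (sym_graph G) (x, y) ->
  p (iter n T x) (iter n T y) @[n --> \oo] --> (0 : R).
Proof.
move=> xy; apply: (cvg0_gauge f_nd) => //.
apply: (squeeze_cvgr _ (cvg_cst _) (cvg_expr_alpha (f (p x y)))).
by near=> n; rewrite f_ge0//= iter_gauge_le.
Unshelve. all: by end_near. Qed.

Lemma p_cvg_trans {x_ y_ : nat -> X} {u : X} :
  p (x_ n) (y_ n) @[n --> \oo] --> (0 : R) -> p_cvg p y_ u -> p_cvg p x_ u.
Proof.
move=> xy yu; rewrite /p_cvg.
have xyu : p (x_ n) (y_ n) + p (y_ n) u @[n --> \oo] --> (0 : R).
  by rewrite -[0](addr0 0); exact: cvgD xy yu.
apply: (squeeze_cvgr _ (cvg_cst _) xyu).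
by near=> n; rewrite p_ge0 p_tri.
Unshelve. all: by end_near. Qed.

Lemma iter_cvg0 {x y} : has_path (sym_graph G) x y ->
  p (iter n T x) (iter n T y) @[n --> \oo] --> (0 : R).
Proof.
case=> s; elim: s x => [|z s IHs] x /=.
  (* Since [p x x] may be nonzero, the empty path is treated as a loop, which is an edge. *)
  by move=> _ ->; apply: iter_cvg0_edge; exact: edges_loop.
move=> /andP[/set_mem/= xz zs] sy.
have xzy : p (iter n T x) (iter n T z) + p (iter n T z) (iter n T y)
    @[n --> \oo] --> (0 : R).
  by rewrite -[0](addr0 0); exact: cvgD (iter_cvg0_edge xz) (IHs _ zs sy).
apply: (squeeze_cvgr _ (cvg_cst _) xzy).
by near=> n; rewrite p_ge0 p_tri.
Unshelve. all: by end_near. Qed.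

(** Both orders of the arguments are bounded because [p] need not be symmetric. *)
Lemma orbit_gauge_bound {x} : C_ G T x -> exists M : R,
  forall k, f (p x (iter k T x)) <= M /\ f (p (iter k T x) x) <= M.
Proof.
move=> Cx; have f0 y z : 0 <= f (p y z) by exact: f_ge0.
have alpha_ge0 := ltW alpha_gt0.
have alpha1_gt0 : 0 < 1 - alpha by rewrite subr_gt0.
(* The number [c / (1 - alpha)] is the fixed point of [t |-> c + alpha * t]. *)
have bound (c : R) (u : nat -> R) : 0 <= c ->
    (forall k, 0 <= u k) -> (forall k, u k.+1 <= c + alpha * u k) ->
    forall k, u k <= u 0%N + c / (1 - alpha).
  move=> c_ge0 u_ge0 uS; have c'_ge0 : 0 <= c / (1 - alpha).
    by rewrite divr_ge0// ltW.
  have cE : c / (1 - alpha) = c + alpha * (c / (1 - alpha)).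
    by field; rewrite gt_eqF.
  elim=> [|k IHk]; first lra.
  have u0_ge0 := u_ge0 0%N; have uk := uS k; rewrite cE.
  have : alpha * u k <= alpha * (u 0%N + c / (1 - alpha)).
    by rewrite ler_wpM2l//; lra.
  have : alpha * u 0%N <= u 0%N by rewrite ler_piMl// ltW.
  by lra.
(* Here [c] is the sum of the constants of the two recurrences, so that one bound serves both;
   [f (p x x)] is the initial term of each. *)
exists (f (p x x) + (f (p x (T x)) + f (p (T x) x)) / (1 - alpha)) => k.
split.
- apply: (bound _ (fun k => f (p x (iter k T x)))) => // [|{}k].
    by rewrite addr_ge0.
  (* Passing through [T x] leaves the image of the pair [(x, iter k T x)], an edge because [x] is in
     [C_ G T]. *)
  apply: le_trans (_ : f (p x (T x) + p (T x) (iter k.+1 T x)) <= _).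
    by apply: f_nd; rewrite ?nnegrE ?addr_ge0.
  apply: le_trans (f_subadd _ _ _ _) _ => //.
  by move: (fT _ _ (Cx k 0%N)) (f0 (T x) x) => /=; lra.
- apply: (bound _ (fun k => f (p (iter k T x) x))) => // [|{}k].
    by rewrite addr_ge0.
  apply: le_trans (_ : f (p (iter k.+1 T x) (T x) + p (T x) x) <= _).
    by apply: f_nd; rewrite ?nnegrE ?addr_ge0.
  apply: le_trans (f_subadd _ _ _ _) _ => //.
  by move: (fT _ _ (Cx 0%N k)) (f0 x (T x)) => /=; lra.
Qed.

Lemma orbit_p_cauchy {x} : C_ G T x -> p_cauchy p (fun n => iter n T x).
Proof.
move=> Cx; have [M fM] := orbit_gauge_bound Cx.
have M_ge0 : 0 <= M by apply: le_trans (fM 0%N).1; exact: f_ge0.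
have aM_ge0 n : 0 <= alpha ^+ n * M by rewrite mulr_ge0 ?exprn_ge0// ltW.
apply: (cvg0_gauge f_nd) => //.
(* The sum covers both orders: the first term is the bound if [m <= n], the second if [n <= m]. *)
have aM0 : alpha ^+ mn.1 * M + alpha ^+ mn.2 * M
    @[mn --> (\oo, \oo)] --> (0 : R).
  rewrite -[0](addr0 0); apply: cvgD.
    exact: cvg_comp cvg_fst (cvg_expr_alpha M).
  exact: cvg_comp cvg_snd (cvg_expr_alpha M).
apply: (squeeze_cvgr _ (cvg_cst _) aM0).
near=> mn; rewrite f_ge0//=; case: {+}mn => m n /=.
have le_aM k y z : edges (sym_graph G) (y, z) -> f (p y z) <= M ->
    f (p (iter k T y) (iter k T z)) <= alpha ^+ k * M.
  move=> yz fyz; apply: le_trans (iter_gauge_le _ yz) _.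
  by rewrite ler_wpM2l// exprn_ge0// ltW.
(* The smaller number of iterations is factored out, leaving an edge between [x] and a later
   iterate, with gauge at most [M]. *)
have [mn'|/ltnW nm] := leqP m n.
  rewrite -{1}(subnKC mn') iterD ler_wpDr//; apply: le_aM; first exact: Cx _ 0%N.
  by case: (fM (n - m)%N).
rewrite -{1}(subnKC nm) iterD ler_wpDl//; apply: le_aM; first exact: Cx 0%N _.
by case: (fM (m - n)%N).
Unshelve. all: by end_near. Qed.

End gauge_contraction.

(** * Uniqueness of limits and the Picard property *)

Lemma p_cvg_unique {R : realType} {X : uniformType} {p : X -> X -> R}
    {x_ : nat -> X} {u v : X} :
  separated_uniform X -> E_distance p -> p_cvg p x_ u -> p_cvg p x_ v -> u = v.
Proof.
move=> sepX [p_ge0 p_ent _] xu xv.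
suff : (\bigcap_(V in @entourage X) V) (u, v) by rewrite sepX.
move=> V /p_ent[d d_gt0 pV].
(* A late term [x_ n] is the common point [z] in the first condition on an E-distance. *)
have [n [/= xun xvn]] : exists n, `|p (x_ n) u| <= d /\ `|p (x_ n) v| <= d.
  apply: (@filter_ex _ \oo); apply: filterI.
    exact: (cvgr0_norm_le _ xu).
  exact: (cvgr0_norm_le _ xv).
by apply: (pV _ _ (x_ n)); apply: le_trans (ler_norm _) _.
Qed.

Theorem theorem2 (R : realType) (X : uniformType) (p : X -> X -> R)
    (G : graph X) (T : X -> X) (phi : R -> R)
    (X_nonempty : [set: X] !=set0)
    (X_separated : separated_uniform X)
    (p_E_distance : E_distance p)
    (X_p_complete : p_complete p)
    (T_contraction : integral_type_contraction p G phi T)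
    (phi_subadditive : forall a b : R, 0 <= a -> 0 <= b ->
       (integral_from0 phi (a + b) <= integral_from0 phi a + integral_from0 phi b)%E)
    (G_weakly_connected : weakly_connected G)
    (C_T_nonempty : C_ G T !=set0) :
  (exists! u : X, forall x : X, p_cvg p (fun n => iter n T x) u) /\
  (p_Picard p T <-> Fix T !=set0).
Proof.
have [T_edge Pphi [alpha /andP[alpha_gt0 alpha_lt1] phiT]] := T_contraction.
have phi_fin a := integral_from0_fin_num phi a Pphi.
pose f a : R := fine (integral_from0 phi a).
have f_nd : {in Num.nneg &, {homo f : x y / x <= y}}.
  by move=> a b _ _ ab; rewrite fine_le// integral_from0_le.
have f_gt0 e : 0 < e -> 0 < f e.
  by case: Pphi => _ _ phi_int /phi_int; exact: fine_gt0.
have f_subadd a b : 0 <= a -> 0 <= b -> f (a + b) <= f a + f b.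
  move=> a0 b0; rewrite -fineD//; apply: fine_le; first exact: phi_fin.
    by rewrite fin_numD !phi_fin.
  exact: phi_subadditive.
have fT x y : edges (sym_graph G) (x, y) ->
    f (p (T x) (T y)) <= alpha * f (p x y).
  by move=> /phiT; rewrite -lee_fin EFinM !fineK.
have iter0 x y : p (iter n T x) (iter n T y) @[n --> \oo] --> (0 : R).
  exact: (@iter_cvg0 _ _ p G T f alpha).
have [x0 Cx0] := C_T_nonempty.
have [|u x0u] := X_p_complete (fun n => iter n T x0).
  exact: (@orbit_p_cauchy _ _ p G T f alpha).
have iter_cvg v y : p_cvg p (fun n => iter n T y) v ->
    forall x, p_cvg p (fun n => iter n T x) v.
  by move=> yv x; apply: p_cvg_trans (iter0 x y) yv.
have lim_unique v w : (forall x, p_cvg p (fun n => iter n T x) v) ->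
    (forall x, p_cvg p (fun n => iter n T x) w) -> v = w.
  by move=> xv xw; exact: p_cvg_unique (xv x0) (xw x0).
have iter_fix v n : Fix T v -> iter n T v = v.
  by move=> Tv; elim: n => //= n ->.
(* The orbit of [v] is constant, so comparing any orbit with it is convergence to [v]; two fixed
   points then agree by [lim_unique]. *)
have fix_lim v : Fix T v -> forall x, p_cvg p (fun n => iter n T x) v.
  move=> Tv x; have := iter0 x v; rewrite /p_cvg.
  by under eq_cvg do rewrite (iter_fix v _ Tv).
split.
  exists u; split; first exact: iter_cvg x0u.
  by move=> v; apply: lim_unique; exact: iter_cvg x0u.
split=> [[v [[Tv _] _]]|[v Tv]]; first by exists v.
exists v; split; last exact: fix_lim.
by split=> // w Tw; apply: lim_unique; exact: fix_lim.
Qed.
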